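(* Let $n\geq 3$, and let $\mathfrak{A}_n \subset \mathfrak{A}_{n+1}$ be the standard inclusion of alternating groups. Then the ring extension $\mathbb{C}\mathfrak{A}_n\subset\mathbb{C}\mathfrak{A}_{n+1}$ has depth $2(n-\lceil\sqrt{n}\rceil)+1$.
   Context: For finite groups $H\subseteq G$ let $\mathrm{Irr}(G)=\{\chi_1,\dots,\chi_s\}$ and $\mathrm{Irr}(H)=\{\psi_1,\dots,\psi_r\}$ be the irreducible complex characters; the inclusion matrix of $\mathbb{C}H\subseteq\mathbb{C}G$ is the $r\times s$ matrix $M=(m_{ij})$ with $m_{ij}=\langle \psi_i, \chi_j\!\downarrow_H\rangle$. Powers of $M$ are understood as $M^1=M$, $M^2=MM^t$, $M^3=MM^tM$, etc., and inequalities between matrices are entrywise. The matrix $M$ satisfies a depth $k$ inequality ($k\ge 2$) if $M^{k+1}\le qM^{k-1}$ for some positive integer $q$; the depth of $\mathbb{C}H\subseteq\mathbb{C}G$ is the least $k\ge 2$ for which a depth $k$ inequality holds. *)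

(* Defs.v *)
From HB Require Import structures.
From mathcomp Require Import all_boot all_order all_fingroup all_algebra.
From mathcomp Require Import all_solvable all_field all_character.

Set Implicit Arguments.
Unset Strict Implicit.
Unset Printing Implicit Defensive.

Import Order.TTheory GRing.Theory Num.Theory GroupScope.

Local Open Scope ring_scope.

(* The type of M^k, for M of size r x s, is r x s for k odd and r x r for k
   even; [alt_width] is defined so that [alt_width r s k.+2] and
   [alt_width r s k] are convertible, hence M^(k+1) and M^(k-1) have the same
   type once k is a successor. *)
Fixpoint alt_width (r s k : nat) : nat :=
  match k with
  | 0 => r
  | 1 => s
  | k'.+2 => alt_width r s k'
  end.

(* M^1 = M, M^2 = M M^T, M^3 = M M^T M, and so on; the associativity chosen is
   M^(k+2) = M (M^T M^k).  The value M^0 = 1 is never used in [depth_ineq] for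
   k >= 2. *)
Fixpoint alt_pow (R : pzRingType) (r s : nat) (M : 'M[R]_(r, s)) (k : nat) :
    'M[R]_(r, alt_width r s k) :=
  match k with
  | 0 => 1%:M
  | 1 => M
  | k'.+2 => M *m (M^T *m alt_pow M k')
  end.

Lemma alt_pow2 (R : pzRingType) r s (M : 'M[R]_(r, s)) :
  alt_pow M 2 = M *m M^T.
Proof. by rewrite /= mulmx1. Qed.

Lemma alt_pow3 (R : pzRingType) r s (M : 'M[R]_(r, s)) :
  alt_pow M 3 = M *m M^T *m M.
Proof. by rewrite /= mulmxA. Qed.

(* M^(k+1) <= q M^(k-1) entrywise, for some positive integer q.  Only k >= 2 is
   meaningful; the case k = 0 is a dummy. *)
Definition depth_ineq (R : numDomainType) (r s : nat) (M : 'M[R]_(r, s))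
    (k : nat) : Prop :=
  match k with
  | 0 => False
  | k'.+1 => exists q : nat, (0 < q)%N /\
      forall i j, alt_pow M k'.+2 i j <= q%:R * alt_pow M k' i j
  end.

(* Complex characters of finite groups take their values in [algC], and
   [Iirr] indexes the irreducible ones. The entries are natural numbers, so the
   partial order of [algC] compares them as usual. *)
Definition inclusion_mx (gT : finGroupType) (H G : {group gT}) :
    'M[algC]_(Nirr H, Nirr G) :=
  \matrix_(i < Nirr H, j < Nirr G) '['chi[H]_i, 'Res[H] 'chi[G]_j]_H.

Definition has_depth (gT : finGroupType) (H G : {group gT}) (d : nat) : Prop :=
  [/\ (2 <= d)%N,
      depth_ineq (inclusion_mx H G) d
    & forall k : nat, (2 <= k)%N -> depth_ineq (inclusion_mx H G) k ->
        (d <= k)%N].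

(* The standard embedding of S_n into S_(n+1), as the permutations fixing the
   last point. *)
Definition lift_last (n : nat) (s : 'S_n) : 'S_n.+1 :=
  lift_perm ord_max ord_max s.

Lemma lift_lastM n : {in [set: 'S_n] &, {morph @lift_last n : s t / (s * t)%g}}.
Proof. by move=> s t _ _; rewrite /lift_last lift_permM. Qed.

Canonical lift_last_morphism n := Morphism (@lift_lastM n).

Definition std_Alt (n : nat) : {group 'S_n.+1} :=
  (lift_last_morphism n @* 'Alt_('I_n))%G.

Lemma lift_last_inj n : injective (@lift_last n).
Proof.
move=> s t /permP eq_st; apply/permP => i.
by have := eq_st (lift ord_max i); rewrite !lift_perm_lift => /lift_inj.
Qed.

Lemma std_Alt_isog n : 'Alt_('I_n) \isog std_Alt n.
Proof.
apply: sub_isog; first exact: subsetT.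
by apply/injmP => s t _ _; apply: lift_last_inj.
Qed.

Lemma std_Alt_sub n : std_Alt n \subset 'Alt_('I_n.+1).
Proof.
apply/subsetP => _ /morphimP[s _ + ->].
by rewrite !Alt_even /= odd_lift_perm addbb.
Qed.

Definition ceil_sqrt (n : nat) : nat := `|Num.ceil (sqrtC n%:R : algC)|%N.

Lemma ceil_sqrtE n : (ceil_sqrt n)%:Z = Num.ceil (sqrtC n%:R : algC).
Proof.
rewrite /ceil_sqrt gez0_abs //.
have sn0 : 0 <= sqrtC n%:R :> algC by rewrite sqrtC_ge0 ler0n.
by rewrite -(ler0z algC) (le_trans sn0) // real_ceil_ge // ger0_real.
Qed.

(* Truncated subtraction in n - ceil_sqrt n is harmless. *)
Lemma ceil_sqrt_le n : (ceil_sqrt n <= n)%N.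
Proof.
have sn0 : 0 <= sqrtC n%:R :> algC by rewrite sqrtC_ge0 ler0n.
rewrite -lez_nat ceil_sqrtE real_ceil_le_int ?ger0_real //.
rewrite -(@ler_pXn2r _ 2) ?nnegrE ?ler0n ?ler0z // sqrtCK.
rewrite -pmulrn -natrX ler_nat; case: n {sn0} => // n.
by rewrite expnS expn1 leq_pmulr.
Qed.

(* Main.v *)
Require Import Defs.
From mathcomp Require Import all_boot all_order all_fingroup all_algebra.
From mathcomp Require Import all_solvable all_field all_character.
From mathcomp Require Import zify.

(** With N = M M^T, the entry N^m(i,j) is the multiplicity of psi_i in the m-th
    iterate of Res Ind on psi_j.  The iterates are products with powers of the
    permutation character Ind 1 of the points, so they decompose over the
    pointwise stabilizers of tuples, which are smaller alternating groups.  With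
    c the least integer such that n <= c^2, two facts about Irr(A_n) give the
    depth: every irreducible character of A_n has a nonzero A_c-invariant, so any
    two of them are joined within n - c steps; and some irreducible character has
    no nonzero A_(c+1)-invariant, hence is not reached from the trivial one in
    fewer than n - c steps.

    For the first fact, take a coloring of the points, maximal for the sum of the
    squares of its color classes, whose stabilizer has a nonzero invariant v in
    the induced representation of S_n.  If some class has c points we are done.
    Otherwise there are at least c classes, since n > (c-1)^2; maximality
    forces the sum of the transpositions of y with a larger class to act on v by
    -1, so antisymmetrizing v over a transversal of the classes does not kill
    it.

    For the second fact, place the n points in a c x c grid and take a common
    constituent of the permutation character on the row stabilizer and of the
    signed one on the column stabilizer. *)

Set Implicit Arguments.
Unset Strict Implicit.
Unset Printing Implicit Defensive.

Import Order.TTheory GRing.Theory Num.Theory GroupScope.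

Local Open Scope ring_scope.

(* Permutations supported on a given set, as opposed to [alt.Sym], which takes
   a type. *)
Local Notation Sym := perm.Sym.

(** * Permutations supported on a subset *)

Lemma exists_subset_card (T : finType) (A : {set T}) k :
  (k <= #|A|)%N -> exists2 B : {set T}, B \subset A & #|B| = k.
Proof.
rewrite -bin_gt0 -cards_draws => /card_gt0P[B]; rewrite inE => /andP[sBA /eqP cB].
by exists B.
Qed.

Lemma tperm_Sym (T : finType) (D : {set T}) x y :
  x \in D -> y \in D -> tperm x y \in Sym D.
Proof.
move=> xD yD; rewrite inE; apply: subset_trans (tperm_on x y) _.
by apply/subsetP=> z /set2P[]->.
Qed.

Lemma Sym_subset (T : finType) (X Y : {set T}) : X \subset Y -> Sym X \subset Sym Y.
Proof.
by move=> sXY; apply/subsetP=> s; rewrite !inE => /subset_trans; apply.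
Qed.

Lemma Sym_setU1 (T : finType) (Y : {set T}) x s : x \notin Y ->
  (s \in Sym Y) = (s \in Sym (x |: Y)) && (s x == x).
Proof.
move=> xY; apply/idP/andP => [sY|[]].
  split; first by apply: subsetP sY; rewrite Sym_subset ?subsetU1.
  by rewrite (out_perm _ xY) //; move: sY; rewrite inE.
rewrite !inE => /subsetP sxY /eqP sx; apply/subsetP => z sz.
by have:= sxY z sz; rewrite !inE; case: eqP => // zx; rewrite inE zx sx eqxx in sz.
Qed.

(** * Colorings, their stabilizers and their weight *)

Section FiberStabilizers.

Variables (T : finType) (D : {set T}).
Implicit Types (s : {perm T}).

Section AnyLabels.

Variables (U : eqType) (f : T -> U).

(** This is a Young subgroup of [Sym D]. Labels of any type are allowed: colors in [T] serve for
    fixed vectors, natural numbers for the rows and columns of a grid. *)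
Definition fiber_stab := [set s in Sym D | [forall x, f (s x) == f x]].

Lemma fiber_stabP s :
  reflect (s \in Sym D /\ forall x, f (s x) = f x) (s \in fiber_stab).
Proof.
rewrite [s \in fiber_stab]in_set; apply: (iffP andP) => -[-> sE]; split=> //.
  exact/'forall_eqP.
exact/'forall_eqP.
Qed.

Lemma fiber_stab_group_set : group_set fiber_stab.
Proof.
apply/group_setP; split=> [|s t /fiber_stabP[sD sf] /fiber_stabP[tD tf]].
  by apply/fiber_stabP; split=> [|x]; rewrite ?group1 ?perm1.
by apply/fiber_stabP; split=> [|x]; rewrite ?groupM // permM tf sf.
Qed.

Canonical fiber_stab_group := Group fiber_stab_group_set.

Lemma fiber_stab_tperm x y :
  x \in D -> y \in D -> f x = f y -> tperm x y \in fiber_stab.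
Proof.
move=> xD yD fxy; apply/fiber_stabP; split=> [|z]; first exact: tperm_Sym.
by case: tpermP => // ->.
Qed.

End AnyLabels.

Implicit Type f : {ffun T -> T}.

(** Colors are themselves points, so that colorings form a finite type, over which the weight has a
    maximum, and the identity is one of them. *)
Definition fiber f i := [set x in D | f x == i].

Definition recolor f y i := [ffun x => if x == y then i else f x].

Definition weight f := (\sum_i #|fiber f i| ^ 2)%N.

Lemma fiber_recolor f y i : y \in D -> fiber (recolor f y i) i = y |: fiber f i.
Proof.
move=> yD; apply/setP => x; rewrite !inE ffunE.
by case: (x =P y) => [->|//]; rewrite yD eqxx.
Qed.

Lemma fiber_recolor_old f y i : f y != i ->
  fiber (recolor f y i) (f y) = fiber f (f y) :\ y.
Proof.
move=> fyi; apply/setP => x; rewrite !inE ffunE.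
by case: (x =P y) => [->|//]; rewrite eq_sym (negPf fyi) andbF.
Qed.

Lemma fiber_recolor_other f y i j : i != j -> f y != j ->
  fiber (recolor f y i) j = fiber f j.
Proof.
move=> ij fyj; apply/setP => x; rewrite !inE ffunE.
by case: (x =P y) => [->|//]; rewrite (negPf ij) (negPf fyj).
Qed.

(** If the classes of y and of color i have b + 1 and a points, the sum of squares grows by 2 (a -
    b), and b < a. *)
Lemma weight_recolor f y i : y \in D -> f y != i ->
    (#|fiber f (f y)| <= #|fiber f i|)%N ->
  (weight f < weight (recolor f y i))%N.
Proof.
move=> yD fyi le_fy.
rewrite /weight (bigD1 i) //= [ltnRHS](bigD1 i) //=.
rewrite (bigD1 (f y)) //= [X in (_ < _ + X)%N](bigD1 (f y)) //=.
rewrite fiber_recolor // fiber_recolor_old //.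
under [X in (_ < _ + (_ + X))%N]eq_bigr => j /andP[ji jf].
  rewrite fiber_recolor_other 1?eq_sym //; over.
rewrite !addnA ltn_add2r.
have yf : y \in fiber f (f y) by rewrite inE yD eqxx.
have yi : y \notin fiber f i by rewrite inE (negPf fyi) andbF.
rewrite (cardsD1 y (fiber f (f y))) yf add1n in le_fy *.
rewrite cardsU1 yi add1n -!mulnn; move: le_fy.
set a := #|fiber f i|; set b := #|fiber f (f y) :\ y|; move=> le_ba.
nia.
Qed.

End FiberStabilizers.

(** * Fixed vectors in representations of [Sym D] *)

Section FixedVectors.

Variables (F : numFieldType) (T : finType) (D : {set T}) (d : nat).
Variable rG : mx_representation F (Sym D) d.
Implicit Types (f : {ffun T -> T}) (s : {perm T}) (v : 'rV[F]_d).

(** In the stabilizer of the new coloring, the transpositions of y with its new class represent the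
    cosets of the subgroup fixing y. That subgroup preserves the old coloring, hence fixes v, and u
    is a relative trace. *)
Lemma recolor_fixed f y i v : y \in D -> f y != i ->
    {in fiber_stab D f, forall s, v *m rG s = v} ->
  let u := \sum_(x in fiber D (recolor f y i) i) v *m rG (tperm x y) in
  {in fiber_stab D (recolor f y i), forall s, u *m rG s = u}.
Proof.
move=> yD fyi vfix u g gf'; have /fiber_stabP[gD gE] := gf'.
have xD z : z \in fiber D (recolor f y i) i -> z \in D by rewrite inE => /andP[].
have f'i z : z \in fiber D (recolor f y i) i -> recolor f y i z = i.
  by rewrite inE => /andP[_ /eqP].
have giE z : (g z \in fiber D (recolor f y i) i) = (z \in fiber D (recolor f y i) i).
  by rewrite !inE gE; congr (_ && _); rewrite perm_closed //; move: gD; rewrite inE.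
have f'y : recolor f y i y = i by rewrite ffunE eqxx.
rewrite /u mulmx_suml [RHS](reindex_inj (@perm_inj _ g)) /=.
apply: eq_big => [x|x xi]; first by rewrite giE.
have gxi : g x \in fiber D (recolor f y i) i by rewrite giE.
have [tD t'D] := (tperm_Sym (xD _ xi) yD, tperm_Sym (xD _ gxi) yD).
set h := (tperm x y * g * tperm (g x) y)%g.
have -> : rG (tperm x y) = rG (tperm x y * g * tperm (g x) y)%g *m
    rG (tperm (g x) y) *m rG g^-1%g.
  by rewrite -!repr_mxM ?groupM ?groupV // -!mulgA tpermKg mulgV mulg1.
rewrite !mulmxA -mulmxA -repr_mxM ?groupV // mulVg repr_mx1 mulmx1.
congr (_ *m _); apply: vfix.
have hf' : h \in fiber_stab D (recolor f y i).
  have st z : z \in fiber D (recolor f y i) i -> tperm z y \in fiber_stab D (recolor f y i).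
    by move=> zi; apply: fiber_stab_tperm (xD z zi) yD _; rewrite f'y f'i.
  by rewrite !groupM ?st.
have hy : h y = y by rewrite /h !permM tpermR tpermL.
case/fiber_stabP: hf' => hD hE; apply/fiber_stabP; split=> // z.
have [->|zy] := eqVneq z y; first by rewrite -/h hy.
have := hE z; rewrite !ffunE (negPf zy) ifN //.
by apply: contraNneq zy => hzy; apply/eqP/(@perm_inj _ h); rewrite hy.
Qed.

Definition sign_sum (Y : {set T}) : 'M[F]_d :=
  \sum_(s in Sym Y) (-1) ^+ odd_perm s *: rG s.

(** Split [Sym (x |: Y)] by the point y sent to x: each part is [tperm x y] times [Sym Y], with sign
    -1 unless y = x. *)
Lemma sign_sum_setU1 (Y : {set T}) x : x |: Y \subset D -> x \notin Y ->
  sign_sum (x |: Y) = (1%:M - \sum_(y in Y) rG (tperm x y)) *m sign_sum Y.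
Proof.
move=> sxYD xY; have xxY : x \in x |: Y by rewrite setU11.
have sD : {subset Sym (x |: Y) <= Sym D} by apply/subsetP/Sym_subset.
rewrite /sign_sum (partition_big (fun s : {perm T} => s^-1%g x) [in x |: Y]); last first.
  by move=> s sxY /=; rewrite perm_closed // perm_onV //; move: sxY; rewrite inE.
transitivity (\sum_(y in x |: Y) ((-1) ^+ (x != y) *: rG (tperm x y)) *m sign_sum Y).
  apply: eq_bigr => y yY; rewrite (reindex_inj (mulgI (tperm x y))) /=.
  have tY : tperm x y \in Sym (x |: Y) by rewrite tperm_Sym.
  rewrite mulmx_sumr; apply: eq_big => [h|h].
    rewrite [RHS](Sym_setU1 _ xY) groupMl //; congr (_ && _).
    by rewrite (can2_eq (permKV _) (permK _)) permM tpermR eq_sym.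
  rewrite groupMl // => /andP[hY _].
  rewrite repr_mxM ?sD // odd_permM odd_tperm signr_addb.
  by rewrite -scalemxAl -scalemxAr scalerA.
rewrite -mulmx_suml big_setU1 //= eqxx expr0 scale1r tperm1 repr_mx1.
congr ((_ + _) *m _); rewrite -sumrN; apply: eq_bigr => y yY.
suff -> : x != y by rewrite expr1 scaleN1r.
by apply: contraNneq xY => ->.
Qed.

Lemma sign_sumM (Y : {set T}) g : Y \subset D -> g \in Sym Y ->
  sign_sum Y *m rG g = (-1) ^+ odd_perm g *: sign_sum Y.
Proof.
move=> sYD gY; have sD : {subset Sym Y <= Sym D} by apply/subsetP/Sym_subset.
rewrite /sign_sum mulmx_suml scaler_sumr [RHS](reindex_inj (mulIg g)) /=.
apply: eq_big => [s|s sY]; first by rewrite groupMr.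
rewrite repr_mxM ?sD // scalerA odd_permM signr_addb mulrCA -signr_addb addbb mulr1.
by rewrite scalemxAl.
Qed.

Lemma sign_sum_comm (Y : {set T}) x z : Y \subset D -> x \in D -> z \in D ->
  x \notin Y -> z \notin Y -> rG (tperm x z) *m sign_sum Y = sign_sum Y *m rG (tperm x z).
Proof.
move=> sYD xD zD xY zY; rewrite /sign_sum mulmx_sumr mulmx_suml.
have sD : {subset Sym Y <= Sym D} by apply/subsetP/Sym_subset.
apply: eq_bigr => s sY; rewrite -scalemxAr -scalemxAl -!repr_mxM ?tperm_Sym ?sD //.
congr (_ *: rG _); apply: (@perm_onC _ [set x; z] Y); rewrite ?tperm_on //.
  by move: sY; rewrite inE.
by rewrite disjoints_subset; apply/subsetP=> t; rewrite in_setC => /set2P[]->.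
Qed.

Section MaximalColoring.

Variables (f : {ffun T -> T}) (v : 'rV[F]_d).
Hypothesis v_fix : {in fiber_stab D f, forall s, v *m rG s = v}.
Hypothesis f_max : forall (f' : {ffun T -> T}) (u : 'rV[F]_d),
  (weight D f < weight D f')%N ->
  {in fiber_stab D f', forall s, u *m rG s = u} -> u = 0.

(* Moving y to a fiber at least as large as its own would increase the weight. *)
Lemma sum_tperm_fiber y i : y \in D -> f y != i ->
    (#|fiber D f (f y)| <= #|fiber D f i|)%N ->
  \sum_(x in fiber D f i) v *m rG (tperm x y) = - v.
Proof.
move=> yD fyi le_fy; apply/eqP; rewrite -addr_eq0 addrC; apply/eqP.
have := f_max (weight_recolor yD fyi le_fy) (recolor_fixed yD fyi v_fix).
rewrite fiber_recolor // big_setU1 /=; last by rewrite inE (negPf fyi) andbF.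
by rewrite tperm1 repr_mx1 mulmx1.
Qed.

Definition stab_sum : 'M[F]_d := \sum_(s in fiber_stab D f) rG s.

Lemma mul_stab_sum g : g \in fiber_stab D f -> rG g *m stab_sum = stab_sum.
Proof.
move=> gf; have sD : {subset fiber_stab D f <= Sym D} by move=> s /fiber_stabP[].
rewrite /stab_sum mulmx_sumr [RHS](reindex_inj (mulgI g)) /=.
apply: eq_big => [s|s sf]; first by rewrite groupMl.
by rewrite repr_mxM ?sD.
Qed.

(* The transversal is built from its smallest fiber up, so that [sum_tperm_fiber]
   applies to each new point x, and each new factor 1 + #|Z| / #|fiber of x| is
   positive. *)
Lemma sign_sum_stab_sum (Y : {set T}) : Y \subset D -> {in Y &, injective f} ->
  exists2 k : F, 0 < k & v *m sign_sum Y *m stab_sum = k *: v.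
Proof.
have [m] := ubnP #|Y|; elim: m Y => // m IHm Y; rewrite ltnS => leYm sYD f_inj.
have [->|[x0 x0Y]] := set_0Vmem Y.
  exists #|fiber_stab D f|%:R; first by rewrite ltr0n cardG_gt0.
  rewrite /sign_sum (big_pred1 1%g) => [|s]; last first.
    rewrite !inE /perm_on; apply/idP/eqP => [|->]; last first.
      by apply/subsetP=> z; rewrite inE perm1 eqxx.
    move/subsetP=> s0; apply/permP=> z; rewrite perm1; apply/eqP.
    by apply: contraT => sz; have := s0 z sz; rewrite inE.
  rewrite odd_perm1 scale1r repr_mx1 mulmx1 /stab_sum mulmx_sumr.
  by rewrite (eq_bigr _ v_fix) sumr_const scaler_nat.
case: (@arg_maxnP _ x0 [in Y] (fun x => #|fiber D f (f x)|) x0Y) => x /= xY x_max.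
pose Z := Y :\ x; have defY : Y = x |: Z by rewrite setD1K.
have xZ : x \notin Z by rewrite !inE eqxx.
have sZY : Z \subset Y by rewrite subsetDl.
have [|||k k0 IHk] := IHm Z.
- by rewrite (cardsD1 x Y) xY in leYm.
- exact: subset_trans sYD.
- exact: sub_in2 (subsetP sZY) _ f_inj.
have xD := subsetP sYD x xY; have xf : x \in fiber D f (f x) by rewrite inE xD eqxx.
have n0 : (0 < #|fiber D f (f x)|)%N by apply/card_gt0P; exists x.
pose n := #|fiber D f (f x)|%:R : F.
have n_gt0 : 0 < n by rewrite ltr0n.
(* All z in the class of x give the same vector as x does; by [sum_tperm_fiber] these [n] vectors
   add up to [- k *: v]. *)
have key y : y \in Z ->
    v *m rG (tperm x y) *m sign_sum Z *m stab_sum = - (n^-1 * k) *: v.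
  move=> yZ; have yY := subsetP sZY y yZ; have yD := subsetP sYD y yY.
  have fxy : f y != f x.
    by apply: contraNneq xZ => /(f_inj _ _ yY xY) <-.
  have /(congr1 (fun u => u *m sign_sum Z *m stab_sum)) :=
    sum_tperm_fiber yD fxy (x_max y yY).
  rewrite !mulNmx IHk !mulmx_suml => eqk.
  have eqz z : z \in fiber D f (f x) -> v *m rG (tperm z y) *m sign_sum Z *m stab_sum
      = v *m rG (tperm x y) *m sign_sum Z *m stab_sum.
    rewrite inE => /andP[zD /eqP fz].
    have gf : tperm x z \in fiber_stab D f by rewrite fiber_stab_tperm.
    have zZ : z \notin Z.
      apply: contraNN xZ => zZ; rewrite -(f_inj z x) //; exact: (subsetP sZY).
    (* Of the two outer factors [tperm x z], v absorbs the first; the last commutes with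
       [sign_sum Z], as x and z lie outside [Z], and [stab_sum] absorbs it. *)
    have -> : tperm z y = (tperm x z * tperm x y * tperm x z)%g.
      rewrite -{1}(tpermV x z) -mulgA -/(conjg _ _) tpermJ tpermL tpermD //.
        by apply: contraNneq fxy => <-.
      by apply: contraNneq fxy => <-; rewrite fz.
    rewrite !repr_mxM ?groupM ?tperm_Sym // !mulmxA (v_fix gf).
    rewrite -(mulmxA _ (rG (tperm x z))) sign_sum_comm ?(subset_trans sZY) //.
    by rewrite -!mulmxA (mul_stab_sum gf).
  rewrite (eq_bigr _ eqz) sumr_const -scaler_nat -/n in eqk.
  apply: (scalerI (lt0r_neq0 n_gt0)).
  by rewrite eqk scalerA mulrN mulVKf ?gt_eqF // scaleNr.
exists (k * (1 + #|Z|%:R / n)).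
  by rewrite mulr_gt0 // ltr_wpDr // divr_ge0 ?ler0n // ltW.
rewrite {1}defY sign_sum_setU1 -?defY //.
rewrite mulmxA mulmxBr mulmx1 !mulmxBl IHk (mulmx_sumr v) !mulmx_suml.
rewrite (eq_bigr _ key) sumr_const -scaler_nat scalerA -scaleNr -scalerDl.
congr (_ *: _); rewrite mulrN opprK mulrDr mulr1; congr (_ + _).
by rewrite [RHS]mulrCA [k * _]mulrC.
Qed.

End MaximalColoring.

(** A color class with c points yields a vector fixed by all of [Sym X], a transversal of c classes
    one on which [Sym X] acts by the sign. Even permutations cover both cases. *)
Lemma Sym_repr_even_fixed c : (0 < d)%N -> (0 < c)%N -> (c.-1 ^ 2 < #|D|)%N ->
  exists X : {set T}, exists w : 'rV[F]_d,
  [/\ X \subset D, #|X| = c, w != 0 &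
      {in Sym X, forall s, ~~ odd_perm s -> w *m rG s = w}].
Proof.
move=> d_gt0 c_gt0 ltcD.
pose good f := rfix_mx rG (fiber_stab D f) != 0.
(* The identity coloring has a trivial stabilizer, so there are colorings to maximize over. *)
have good_id : good [ffun x => x].
  rewrite /good -mxrank_eq0 -lt0n; apply: leq_trans (_ : \rank (1%:M : 'M[F]_d) <= _)%N.
    by rewrite mxrank1.
  apply/mxrankS/rfix_mxP => s /fiber_stabP[_ sE]; suff ->: s = 1%g by rewrite repr_mx1 mulmx1.
  by apply/permP=> x; have := sE x; rewrite !ffunE perm1.
case: (@arg_maxnP _ _ good (weight D) good_id) => f good_f f_max.
have /rowV0Pn[v /rfix_mxP v_fix v0] := good_f.
have fmax (f' : {ffun T -> T}) (u : 'rV[F]_d) : (weight D f < weight D f')%N ->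
    {in fiber_stab D f', forall s, u *m rG s = u} -> u = 0.
  move=> ltff' ufix; apply: contraTeq ltff' => u0; rewrite -leqNgt; apply: f_max.
  apply: contraNneq u0 => r0; move/rfix_mxP: ufix; rewrite r0 submx0; exact.
have [i lt_ci|small] := pickP (fun i => c <= #|fiber D f i|)%N.
  have [X sXi cX] := exists_subset_card lt_ci; exists X, v; split=> //.
    by apply: subset_trans sXi _; apply/subsetP=> x; rewrite inE => /andP[].
  move=> s sX _; apply: v_fix; apply/fiber_stabP; split.
    apply: subsetP sX; apply: Sym_subset; apply: subset_trans sXi _.
    by apply/subsetP=> x; rewrite inE => /andP[].
  move=> x; have [xX|xX] := boolP (x \in X); last first.
    by rewrite (out_perm _ xX) //; move: sX; rewrite inE.
  have sxX : s x \in X by rewrite perm_closed //; move: sX; rewrite inE.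
  by have := subsetP sXi _ xX; have := subsetP sXi _ sxX; rewrite !inE => /andP[_ /eqP->] /andP[_ /eqP->].
(* Fewer than c classes of at most c - 1 points each would give [D] at most (c - 1)^2 points. *)
have le_cf : (c <= #|f @: D|)%N.
  rewrite leqNgt; apply/negP=> lt_fc; move: ltcD; rewrite ltnNge => /negP; apply.
  have -> : #|D| = (\sum_(i in f @: D) #|fiber D f i|)%N.
    rewrite -sum1_card (partition_big_imset f) /=; apply: eq_bigr => i _.
    by rewrite -sum1_card; apply: eq_bigl => x; rewrite inE.
  apply: leq_trans (_ : \sum_(i in f @: D) c.-1 <= _)%N.
    by apply: leq_sum => i _; rewrite -ltnS prednK // ltnNge small.
  by rewrite sum_nat_const -mulnn leq_mul2r -ltnS prednK // lt_fc orbT.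
have [I sIf cI] := exists_subset_card le_cf.
pose r i := odflt i [pick x in D | f x == i].
have rP i : i \in I -> r i \in D /\ f (r i) = i.
  move/(subsetP sIf)/imsetP=> [x xD ->]; rewrite /r.
  by case: pickP => [z /andP[zD /eqP]|/(_ x)]; rewrite ?xD ?eqxx.
have fK : {in I, cancel r f} by move=> i /rP[].
have sYD : r @: I \subset D by apply/subsetP=> _ /imsetP[i /rP[rD _] ->].
have f_inj : {in r @: I &, injective f}.
  by move=> _ _ /imsetP[i iI ->] /imsetP[j jI ->]; rewrite !fK // => ->.
have [k k0 vk] := sign_sum_stab_sum v_fix fmax sYD f_inj.
exists (r @: I), (v *m sign_sum (r @: I)); split=> //.
- by rewrite card_in_imset //; apply: can_in_inj fK.
- apply: contraNneq v0 => w0; move: vk; rewrite w0 mul0mx => /esym/eqP.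
  by rewrite scaler_eq0 gt_eqF.
move=> s sY even_s; rewrite -mulmxA sign_sumM // (negPf even_s).
by rewrite expr0 scale1r.
Qed.

End FixedVectors.

(** * Sums of characters over subgroups *)

Lemma mxtrace_idem (F : fieldType) n (A : 'M[F]_n) :
  A *m A = A -> \tr A = (\rank A)%:R.
Proof.
move=> AA; rewrite -{1}(mulmx_base A) mxtrace_mulC.
(* The trace is that of the reverse product, whose size is the rank. Cancelling both bases in
   [A *m A = A] makes this product the identity. *)
suff -> : row_base A *m col_base A = 1%:M by rewrite mxtrace1.
apply: (row_full_inj (col_base_full A)); apply: (row_free_inj (row_base_free A)).
by rewrite mulmx1 mulmxA mulmx_base -mulmxA mulmx_base.
Qed.

Section CharacterSums.

Variables (gT : finGroupType) (G : {group gT}).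

(** The mean of [rG] over K is idempotent, so its trace is its rank, which is nonzero because the
    mean fixes w. *)
Lemma cfRepr_sum_fixed_neq0 n (rG : mx_representation algC G n) (K : {group gT})
    (w : 'rV_n) : K \subset G -> w != 0 -> {in K, forall x, w *m rG x = w} ->
  \sum_(x in K) cfRepr rG x != 0.
Proof.
move=> sKG w0 wK; have inG := subsetP sKG.
pose S := \sum_(x in K) rG x; pose k : algC := #|K|%:R.
have k0 : k != 0 by rewrite neq0CG.
have SS : S *m S = k *: S.
  rewrite {1}/S mulmx_suml (eq_bigr (fun=> S)) => [|x Kx].
    by rewrite sumr_const scaler_nat.
  rewrite /S mulmx_sumr [RHS](reindex_inj (mulgI x)) /=.
  by apply: eq_big => [y|y Ky]; rewrite ?groupMl // repr_mxM ?inG.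
have trS : \sum_(x in K) cfRepr rG x = \tr S.
  by rewrite raddf_sum; apply: eq_bigr => x Kx; rewrite cfunE inG.
have wS : w *m (k^-1 *: S) = w.
  rewrite -scalemxAr /S mulmx_sumr (eq_bigr _ wK) sumr_const -scaler_nat scalerA.
  by rewrite mulVf ?scale1r.
have E : (k^-1 *: S) *m (k^-1 *: S) = k^-1 *: S.
  by rewrite -scalemxAl -scalemxAr SS !scalerA mulfVK.
apply: contra_neq w0 => S0; rewrite -wS; suff -> : k^-1 *: S = 0 by rewrite mulmx0.
apply/eqP; rewrite -mxrank_eq0 -(eqr_nat algC) -mxtrace_idem //.
by rewrite mxtraceZ -trS S0 mulr0.
Qed.

Lemma sum_cfun_cfdot (K : {group gT}) (phi : 'CF(G)) (psi : 'CF(K)) : K \subset G ->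
  \sum_(x in K) phi x * (psi x)^* = #|K|%:R * '[phi, 'Ind[G] psi].
Proof.
move=> sKG; rewrite -cfdot_Res_l cfdotE mulVKf ?neq0CG //.
by apply: eq_bigr => x Kx; rewrite cfResE.
Qed.

Lemma sum_cfun_cfdot1 (K : {group gT}) (phi : 'CF(G)) : K \subset G ->
  \sum_(x in K) phi x = #|K|%:R * '[phi, 'Ind[G, K] 1].
Proof.
move=> sKG; rewrite -sum_cfun_cfdot //; apply: eq_bigr => x Kx.
by rewrite cfun1E Kx conjC1 mulr1.
Qed.

(** Mackey's formula, with a sum over all of G in place of double coset representatives. *)
Lemma cfdot_Ind_Ind (H K : {group gT}) (phi : 'CF(H)) (psi : 'CF(K)) :
    H \subset G -> K \subset G ->
  '['Ind[G] phi, 'Ind[G] psi] = #|H|%:R^-1 * (#|K|%:R^-1 *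
     \sum_(a in G) \sum_(x in H :&: K :^ a^-1%g) phi x * (psi (x ^ a)%g)^*).
Proof.
move=> sHG sKG; rewrite -Frobenius_reciprocity cfdotE; congr (_ * _).
transitivity (\sum_(x in H) #|K|%:R^-1 * \sum_(a in G) phi x * (psi (x ^ a)%g)^*).
  apply: eq_bigr => x Hx; rewrite cfResE // cfIndE // rmorphM fmorphV rmorph_nat.
  by rewrite mulrCA rmorph_sum mulr_sumr.
rewrite -mulr_sumr exchange_big; congr (_ * _); apply: eq_bigr => a _.
rewrite (big_setID (K :^ a^-1%g)) /= [X in _ + X]big1 ?addr0 // => x.
by rewrite inE mem_conjgV => /andP[K'x _]; rewrite (cfun0 psi K'x) conjC0 mulr0.
Qed.

Lemma constt_cfdot0 (phi psi : 'CF(G)) i : phi \is a character -> psi \is a character ->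
  '[phi, psi] = 0 -> i \in irr_constt phi -> '[psi, 'chi_i] = 0.
Proof.
move=> Nphi Npsi phi_psi phi_i; apply/eqP; apply: contraT => psi_i.
have := constt_ortho_char Nphi Npsi phi_i psi_i phi_psi.
by move/eqP; rewrite cfnorm_irr oner_eq0.
Qed.

End CharacterSums.

(** * Alternating groups on subsets *)

Section Alternating.

Variable T : finType.
Implicit Types (D X Z : {set T}) (s t : {perm T}).

(** One ambient type for all subsets lets these groups be intersected and conjugated into one
    another. *)
Definition Alt_on D : {group {perm T}} := ('Alt_T :&: Sym D)%G.

Lemma Alt_onP D s : reflect (~~ odd_perm s /\ s \in Sym D) (s \in Alt_on D).
Proof. by rewrite in_setI Alt_even; apply: andP. Qed.

Lemma Alt_on_Sym D : Alt_on D \subset Sym D.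
Proof. exact: subsetIr. Qed.

Lemma Alt_onS D X : X \subset D -> Alt_on X \subset Alt_on D.
Proof. by move=> sXD; rewrite setIS ?Sym_subset. Qed.

Lemma Sym_imJ D s t : ((t ^ s)%g \in Sym (s @: D)) = (t \in Sym D).
Proof.
rewrite !inE; apply/subsetP/subsetP => tD x; rewrite !inE => tx.
  have := tD (s x); rewrite inE permJ (inj_eq perm_inj) => /(_ tx).
  by rewrite mem_imset //; apply: perm_inj.
rewrite -[x](permKV s) mem_imset; last exact: perm_inj.
apply: tD; rewrite inE; apply: contraNneq tx => tx.
by rewrite -{1}[x](permKV s) permJ tx permKV.
Qed.

Lemma Alt_on_imJ D s t : ((t ^ s)%g \in Alt_on (s @: D)) = (t \in Alt_on D).
Proof. by apply/Alt_onP/Alt_onP; rewrite odd_permJ Sym_imJ. Qed.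

(** By induction on the part of X outside Z: swap one of its points with a point of Z outside X. *)
Lemma Sym_im D X Z : X \subset D -> Z \subset D -> #|X| = #|Z| ->
  exists2 s, s \in Sym D & s @: X = Z.
Proof.
move=> + sZD; have [m] := ubnP #|X :\: Z|; elim: m X => // m IHm X.
rewrite ltnS => leXm sXD cXZ.
have cXZ' : #|X :\: Z| = #|Z :\: X| by rewrite !cardsD setIC cXZ.
have [XZ|[x /setDP[xX xZ]]] := set_0Vmem (X :\: Z).
  exists 1%g; rewrite ?group1 //.
  rewrite (eq_imset _ (perm1 (T := T))) imset_id; apply/eqP.
  by rewrite eqEcard cXZ leqnn andbT -setD_eq0 XZ.
have /card_gt0P[z /setDP[zZ zX]] : (0 < #|Z :\: X|)%N.
  by rewrite -cXZ'; apply/card_gt0P; exists x; rewrite inE xZ.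
have [xD zD] := (subsetP sXD x xX, subsetP sZD z zZ).
have xz : x != z by apply: contraNneq zX => <-.
have imX : tperm x z @: X = z |: (X :\ x).
  apply/setP => y; rewrite -{1}[y](tpermK x z) mem_imset; last exact: perm_inj.
  rewrite !inE; case: tpermP => [->|->|/eqP yx /eqP yz].
  - by rewrite (negPf zX) (negPf xz) eqxx.
  - by rewrite xX eqxx.
  - by rewrite (negPf yx) (negPf yz).
have [||| s sD sE] := IHm (tperm x z @: X).
- apply: leq_trans leXm; rewrite (cardsD1 x (X :\: Z)) inE xX xZ add1n ltnS.
  apply: subset_leq_card; apply/subsetP => y; rewrite imX !inE.
  by case: eqP => [->|] //=; rewrite ?zZ // => _ /and3P[-> -> ->].
- rewrite imX subUset sub1set zD; apply: subset_trans sXD; exact: subsetDl.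
- by rewrite card_imset //; apply: perm_inj.
exists (tperm x z * s)%g; first by rewrite groupM ?tperm_Sym.
by rewrite -sE -imset_comp; apply: eq_imset => y; rewrite permM.
Qed.

(** If the permutation found in [Sym D] is odd, a transposition inside Z corrects its parity and
    preserves Z; this takes two points in Z. *)
Lemma Alt_on_im D X Z : X \subset D -> Z \subset D -> #|X| = #|Z| -> (1 < #|Z|)%N ->
  exists2 s, s \in Alt_on D & s @: X = Z.
Proof.
move=> sXD sZD cXZ /card_gt1P[x [y [xZ yZ xy]]].
have [s sD sE] := Sym_im sXD sZD cXZ.
have [odd_s|even_s] := boolP (odd_perm s); last by exists s => //; apply/Alt_onP.
have [xD yD] := (subsetP sZD x xZ, subsetP sZD y yZ).
exists (s * tperm x y)%g.
  by apply/Alt_onP; rewrite odd_permM odd_s odd_tperm xy groupM ?tperm_Sym.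
rewrite -(im_perm_on (S := Z) (u := tperm x y)); last first.
  by have := tperm_Sym xZ yZ; rewrite inE.
by rewrite -sE -imset_comp; apply: eq_imset => z; rewrite permM.
Qed.

Lemma sum_Alt_onJ X s (phi : {perm T} -> algC) :
  \sum_(t in Alt_on X) phi (t ^ s)%g = \sum_(t in Alt_on (s @: X)) phi t.
Proof.
rewrite [RHS](reindex_inj (conjg_inj s)) /=.
by apply: eq_bigl => t; rewrite Alt_on_imJ.
Qed.

(** The sum is the order of [Alt_on Z] times the dimension of the invariants. Inducing to [Sym D]
    provides an invariant vector for some set X of c points, and conjugacy under [Alt_on D] carries
    the result to Z. *)
Lemma irr_Alt_on_fixed D Z c (i : Iirr (Alt_on D)) :
    (1 < c)%N -> (c.-1 ^ 2 < #|D|)%N -> Z \subset D -> #|Z| = c ->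
  \sum_(t in Alt_on Z) 'chi_i t != 0.
Proof.
move=> c1 ltcD sZD cZ; pose Phi := 'Ind[perm.Sym_group D] 'chi_i.
have NPhi : Phi \is a character by rewrite cfInd_char ?irr_char.
have /char_reprP[[d rG] defPhi] := NPhi.
have d_gt0 : (0 < d)%N.
  rewrite lt0n; apply: contra_neq (Ind_irr_neq0 i (Alt_on_Sym D)) => d0.
  by apply/eqP; rewrite -char1_eq0 // -/Phi defPhi cfRepr1 /= pnatr_eq0 d0.
have [|X [w [sXD cX w0 w_fix]]] := Sym_repr_even_fixed rG d_gt0 _ ltcD.
  exact: ltnW.
have sX : Alt_on X \subset Sym D.
  exact: subset_trans (Alt_on_Sym X) (Sym_subset sXD).
have w_fix' : {in Alt_on X, forall s, w *m rG s = w}.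
  by move=> s /Alt_onP[even_s sX']; apply: w_fix.
have := cfRepr_sum_fixed_neq0 sX w0 w_fix'; rewrite -defPhi /Phi.
under eq_bigr do rewrite cfIndE ?Alt_on_Sym //.
rewrite -mulr_sumr exchange_big mulf_eq0 negb_or => /andP[_].
(* The sum of the induced character over [Alt_on X] combines sums of ['chi_i] over conjugates of
   [Alt_on X], and each of these equals the sum over [Alt_on Z]. *)
apply: contra_neq => Z0; apply: big1 => s sD.
have imX : s @: X \subset D.
  rewrite -(im_perm_on (S := D) (u := s)) ?imsetS //; by move: sD; rewrite inE.
have [||t tD tE] := Alt_on_im imX sZD; rewrite ?card_imset ?cX ?cZ //.
  exact: perm_inj.
rewrite sum_Alt_onJ -[RHS]Z0 -tE -[RHS]sum_Alt_onJ.
by apply: eq_bigr => g _; rewrite cfunJ.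
Qed.

Lemma sgn_mx_repr (K : {group {perm T}}) :
  mx_repr K (fun s => ((-1) ^+ odd_perm s)%:M : 'M[algC]_1).
Proof.
split=> [|s t _ _]; first by rewrite odd_perm1.
by rewrite odd_permM signr_addb -scalar_mxM.
Qed.

Definition sgn_char (K : {group {perm T}}) := cfRepr (MxRepresentation (sgn_mx_repr K)).

Lemma sgn_charE (K : {group {perm T}}) s : s \in K -> sgn_char K s = (-1) ^+ odd_perm s.
Proof. by move=> Ks; rewrite cfunE Ks /= mxtrace_scalar. Qed.

Lemma sum_sgn_odd (K : {group {perm T}}) t : t \in K -> odd_perm t ->
  \sum_(s in K) (-1) ^+ odd_perm s = 0 :> algC.
Proof.
move=> Kt odd_t; set S := \sum_(s in K) _; suff /eqP : S = - S.
  by rewrite -addr_eq0 -mulr2n mulrn_eq0 => /eqP.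
rewrite {1}/S (reindex_inj (mulgI t)) -sumrN /=.
apply: eq_big => [s|s _]; first by rewrite groupMl.
by rewrite odd_permM odd_t signrN.
Qed.

Lemma sum_sgn_ge0 (K : {group {perm T}}) :
  0 <= \sum_(s in K) (-1) ^+ odd_perm s :> algC.
Proof.
have [/exists_inP[t Kt odd_t]|all_even] := boolP [exists t in K, odd_perm t].
  by rewrite (sum_sgn_odd Kt odd_t).
apply: sumr_ge0 => s Ks; suff -> : odd_perm s = false by rewrite expr0 ler01.
by apply: contraNF all_even => odd_s; apply/exists_inP; exists s.
Qed.

Lemma cfdot_Ind1_Ind_sgn (G H K : {group {perm T}}) : H \subset G -> K \subset G ->
  '['Ind[G, H] 1, 'Ind[G] (sgn_char K)] = #|H|%:R^-1 * (#|K|%:R^-1 *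
     \sum_(a in G) \sum_(s in H :&: K :^ a^-1%g) (-1) ^+ odd_perm s).
Proof.
move=> sHG sKG; rewrite cfdot_Ind_Ind //; do 2 congr (_ * _).
apply: eq_bigr => a _; apply: eq_bigr => s /setIP[Hs].
rewrite mem_conjgV => Ks; rewrite cfun1E Hs mul1r sgn_charE // odd_permJ.
by rewrite rmorph_sign.
Qed.

(** An odd element makes the sum of signs over each intersection in Mackey's formula vanish. *)
Lemma cfdot_Ind1_Ind_sgn_eq0 (G H K : {group {perm T}}) : H \subset G -> K \subset G ->
    (forall a, a \in G -> exists t, [/\ t \in H, (t ^ a)%g \in K & odd_perm t]) ->
  '['Ind[G, H] 1, 'Ind[G] (sgn_char K)] = 0.
Proof.
move=> sHG sKG oddt; rewrite cfdot_Ind1_Ind_sgn // big1 ?mulr0 // => a /oddt[t [Ht Kt odd_t]].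
by rewrite (@sum_sgn_odd [group of H :&: K :^ a^-1] t) // inE Ht mem_conjgV.
Qed.

(** No term of Mackey's formula is negative, and the term of the identity is 1. *)
Lemma cfdot_Ind1_Ind_sgn_neq0 (G H K : {group {perm T}}) : H \subset G -> K \subset G ->
  H :&: K = 1%g -> '['Ind[G, H] 1, 'Ind[G] (sgn_char K)] != 0.
Proof.
move=> sHG sKG HK1; rewrite cfdot_Ind1_Ind_sgn // !mulf_neq0 ?invr_eq0 ?neq0CG //.
rewrite (bigD1 1%g) ?group1 //= invg1 conjsg1 HK1 big_set1 odd_perm1 expr0.
rewrite gt_eqF // ltr_wpDr ?ltr01 // sumr_ge0 // => a _.
exact: (@sum_sgn_ge0 [group of H :&: K :^ a^-1]).
Qed.

(** * A character with few invariants, from a grid with rows [r] and columns [k] *)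

Section NoFixedVector.

Variables (D : {set T}) (r k : T -> nat) (c : nat).
Hypothesis r_lt : {in D, forall x, r x < c}%N.
Hypothesis k_lt : {in D, forall x, k x < c}%N.
Hypothesis rk_inj : {in D &, forall x y, r x = r y -> k x = k y -> x = y}.

Lemma pigeonhole_label (f : T -> nat) X : {in X, forall x, f x < c}%N ->
  (c < #|X|)%N -> exists x y, [/\ x \in X, y \in X, x != y & f x = f y].
Proof.
move=> f_lt; rewrite ltnNge => /negP ltcX.
have [/dinjectiveP f_inj|] := boolP (dinjectiveb f X); last first.
  by case/dinjectivePn=> x xX [y /andP[yx yX] fxy]; exists x, y; rewrite eq_sym.
case: ltcX; rewrite -[c](size_iota 0) cardE -(size_map f).
apply: uniq_leq_size.
  by rewrite map_inj_in_uniq ?enum_uniq // => x y; rewrite !mem_enum; apply: f_inj.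
by move=> _ /mapP[x xX ->]; rewrite mem_iota f_lt // -mem_enum.
Qed.

(** Two points of the preimage of X under a share a label; their transposition is the required t.
    The conjugation by a matches the terms of Mackey's formula. *)
Lemma odd_fiber_stab (f : T -> nat) X a : {in D, forall x, f x < c}%N ->
    X \subset D -> (c < #|X|)%N -> a \in Sym D ->
  exists t, [/\ t \in fiber_stab D f, (t ^ a)%g \in Sym X & odd_perm t].
Proof.
move=> f_lt sXD ltcX aD; have aVD : a^-1%g \in Sym D by rewrite groupV.
have aVX : a^-1%g @: X \subset D.
  rewrite -(im_perm_on (S := D) (u := a^-1%g)) ?imsetS //; by rewrite inE in aVD.
have [|| x [y [xX yX xy fxy]]] := pigeonhole_label (f := f) (X := a^-1%g @: X).
- by move=> x /(subsetP aVX); apply: f_lt.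
- by rewrite card_imset //; apply: perm_inj.
have [xD yD] := (subsetP aVX x xX, subsetP aVX y yX).
exists (tperm x y); rewrite fiber_stab_tperm // odd_tperm xy; split=> //.
by case/imsetP: xX yX => x' x'X -> /imsetP[y' y'X ->]; rewrite tpermJ !permKV tperm_Sym.
Qed.

Lemma fiber_stab_labels_trivial : fiber_stab D r :&: fiber_stab D k = 1%g.
Proof.
apply/trivgP/subsetP=> s /setIP[/fiber_stabP[sD sr] /fiber_stabP[_ sk]].
rewrite inE; apply/eqP/permP=> x; rewrite perm1.
have sD' : perm_on D s by rewrite inE in sD.
have [xD|xD] := boolP (x \in D); last by rewrite (out_perm sD').
by apply: rk_inj => //; rewrite perm_closed.
Qed.

(* By the pigeonhole principle, a set of more than c points meets some row and
   some column twice, which kills its invariants in the signed character of the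
   columns and its sign-invariants in the permutation character of the rows. *)
Lemma irr_Alt_on_no_fixed : exists i : Iirr (Alt_on D),
  forall X, X \subset D -> (c < #|X|)%N -> \sum_(s in Alt_on X) 'chi_i s = 0.
Proof.
pose G := perm.Sym_group D; pose R := fiber_stab_group D r; pose C := fiber_stab_group D k.
have sRG : R \subset G by apply/subsetP=> s /fiber_stabP[].
have sCG : C \subset G by apply/subsetP=> s /fiber_stabP[].
have N1 (H : {group {perm T}}) : 'Ind[G, H] 1 \is a character.
  by rewrite cfInd_char ?cfun1_char.
have Nsgn (H : {group {perm T}}) : 'Ind[G] (sgn_char H) \is a character.
  by rewrite cfInd_char ?cfRepr_char.
have := cfdot_Ind1_Ind_sgn_neq0 sRG sCG fiber_stab_labels_trivial.
rewrite cfdot_sum_irr => nz.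
have [j /andP[jR jC]] : exists j, ('['Ind[G, R] 1, 'chi_j] != 0)
    && ('['Ind[G] (sgn_char C), 'chi_j] != 0).
  apply/existsP; apply: contraNT nz; rewrite negb_exists => /forallP all0.
  apply/eqP/big1 => j _; have := all0 j; rewrite negb_and !negbK.
  by case/orP=> /eqP->; rewrite ?mul0r ?conjC0 ?mulr0.
have Sym0 X : X \subset D -> (c < #|X|)%N -> \sum_(s in Alt_on X) 'chi_j s = 0.
  move=> sXD ltcX; pose S := perm.Sym_group X.
  have sSG : S \subset G := Sym_subset sXD.
  have sgn0 : '['Ind[G] (sgn_char S), 'chi_j] = 0.
    apply: constt_cfdot0 (N1 R) (Nsgn S) _ _; last by rewrite irr_consttE.
    by apply: cfdot_Ind1_Ind_sgn_eq0 => // a; apply: odd_fiber_stab.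
  have triv0 : '['Ind[G, S] 1, 'chi_j] = 0.
    apply: constt_cfdot0 (Nsgn C) (N1 S) _ _; last by rewrite irr_consttE.
    rewrite cfdotC cfdot_Ind1_Ind_sgn_eq0 ?conjC0 // => a aG.
    have [|t [tC tS odd_t]] := odd_fiber_stab (a := a^-1%g) k_lt sXD ltcX.
      by rewrite groupV.
    by exists (t ^ a^-1)%g; rewrite conjgKV odd_permJ.
  have {}triv0 : \sum_(s in Sym X) 'chi_j s = 0.
    by rewrite (sum_cfun_cfdot1 'chi_j sSG) cfdotC triv0 conjC0 mulr0.
  have {}sgn0 : \sum_(s in Sym X) 'chi_j s * (-1) ^+ odd_perm s = 0.
    transitivity (\sum_(s in S) 'chi_j s * (sgn_char S s)^*).
      by apply: eq_bigr => s sX; rewrite sgn_charE // rmorph_sign.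
    by rewrite sum_cfun_cfdot // cfdotC sgn0 conjC0 mulr0.
  (* The factor 1 + sign is 2 on even permutations and 0 on odd ones, which leaves the sum over
     [Alt_on X]. *)
  have : \sum_(s in Sym X) 'chi_j s * (1 + (-1) ^+ odd_perm s) = 0.
    under eq_bigr do rewrite mulrDr mulr1.
    by rewrite big_split /= triv0 sgn0 addr0.
  rewrite (big_setID 'Alt_T) /= [X in _ + X]big1 => [|s]; last first.
    by rewrite inE Alt_even negbK => /andP[-> _]; rewrite expr1 subrr mulr0.
  rewrite addr0 setIC (eq_bigr (fun s => 2%:R * 'chi_j s)) => [|s]; last first.
    by case/Alt_onP=> /negPf-> _; rewrite expr0 mulrC.
  by move/eqP; rewrite -mulr_sumr mulf_eq0 pnatr_eq0 => /eqP.
have sAG := Alt_on_Sym D.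
(* The restriction of ['chi_j] is orthogonal to the character induced from the trivial one of
   [Alt_on X], hence so is each of its constituents. *)
have [i ij] : exists i, i \in irr_constt ('Res[Alt_on D] 'chi[G]_j).
  by apply/neq0_has_constt; rewrite Res_irr_neq0.
exists i => X sXD ltcX; have sXA := Alt_onS sXD.
rewrite (sum_cfun_cfdot1 'chi_i sXA) cfdotC.
rewrite (@constt_cfdot0 _ _ ('Res[Alt_on D] 'chi[G]_j)) ?conjC0 ?mulr0 //.
- by rewrite cfRes_char ?irr_char.
- by rewrite cfInd_char ?cfun1_char.
have sXG := subset_trans sXA sAG.
have /eqP := Sym0 X sXD ltcX; rewrite (sum_cfun_cfdot1 'chi_j sXG).
rewrite mulf_eq0 (negPf (neq0CG _)) /= => /eqP.
by rewrite cfdot_Res_l cfIndInd.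
Qed.

End NoFixedVector.

End Alternating.

(** * Depth through the powers of M M^T *)

Section DepthCriterion.

Variables (gT : finGroupType) (H G : {group gT}).
Hypothesis sHG : H \subset G.

Let M := inclusion_mx H G.

Let N := M *m M^T.

(** These are the even powers of [M], with a type that does not depend on m. *)
Definition even_pow m := iter m (mulmx N) 1%:M.

Definition ResInd (phi : 'CF(H)) := 'Res[H] ('Ind[G] phi).

Lemma inclusion_mx_nat i j : M i j \in Num.nat.
Proof. by rewrite mxE Cnat_cfdot_char ?cfRes_char ?irr_char. Qed.

Lemma inclusion_mxE i j : M i j = '['Res[H] 'chi[G]_j, 'chi_i].
Proof. by rewrite -[M i j]conj_natr ?inclusion_mx_nat // mxE -cfdotC. Qed.

(** By Frobenius reciprocity M^T describes induction while [M] describes restriction, so [N] is the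
    matrix of [ResInd] on irreducible characters. *)
Lemma MMtr_cfdot (phi : 'CF(H)) i :
  \sum_k N i k * '[phi, 'chi_k] = '[ResInd phi, 'chi_i].
Proof.
transitivity (\sum_j M i j * '['Ind[G] phi, 'chi_j]).
  under eq_bigr do rewrite mxE mulr_suml.
  rewrite exchange_big; apply: eq_bigr => j _.
  rewrite -Frobenius_reciprocity [in RHS]cfdot_sum_irr mulr_sumr.
  apply: eq_bigr => k _; rewrite -mulrA; congr (_ * _).
  by rewrite mxE mulrC -cfdotC [in LHS]mxE.
rewrite /ResInd {2}['Ind[G] phi]cfun_sum_cfdot linear_sum cfdot_suml.
by apply: eq_bigr => j _; rewrite linearZ /= cfdotZl inclusion_mxE mulrC.
Qed.

Lemma even_powE m i j : even_pow m i j = '[iter m ResInd 'chi_j, 'chi_i].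
Proof.
elim: m i => [|m IHm] i /=; first by rewrite mxE cfdot_irr eq_sym.
rewrite -MMtr_cfdot mxE; apply: eq_bigr => k _; congr (_ * _); exact: IHm.
Qed.

(** The projection formula turns each step after the first into multiplication by the permutation
    character. *)
Lemma ResInd_Res (psi : 'CF(G)) : ResInd ('Res[H] psi) = 'Res[H] ('Ind[G, H] 1 * psi).
Proof. by rewrite -cfIndM // mul1r. Qed.

Lemma iter_ResInd_S m phi :
  iter m.+1 ResInd phi = 'Res[H] ('Ind[G] phi * 'Ind[G, H] 1 ^+ m).
Proof.
elim: m => [|m IHm]; first by rewrite expr0 mulr1.
by rewrite iterS IHm ResInd_Res exprS mulrCA.
Qed.

Lemma iter_ResInd_1 m : iter m ResInd 1 = 'Res[H] ('Ind[G, H] 1 ^+ m).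
Proof.
case: m => [|m]; first by rewrite expr0 rmorph1.
by rewrite iter_ResInd_S exprS.
Qed.

Lemma MMtr_nat i k : N i k \in Num.nat.
Proof. by rewrite mxE rpred_sum // => j _; rewrite [M^T _ _]mxE rpredM ?inclusion_mx_nat. Qed.

Lemma even_pow_nat m i j : even_pow m i j \in Num.nat.
Proof.
elim: m i => [|m IHm] i /=; first by rewrite mxE rpred_nat.
by rewrite mxE rpred_sum // => k _; rewrite rpredM ?MMtr_nat ?IHm.
Qed.

(* The trivial character of G is joined to the trivial character of H only. *)
Lemma even_pow_mul_col0 m i : (even_pow m *m M) i 0 = even_pow m i 0.
Proof.
rewrite mxE (bigD1 0) //= big1 ?addr0 => [|k k0];
  by rewrite inclusion_mxE irr0 cfRes_cfun1 // -irr0 cfdot_irr 1?eq_sym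
             ?eqxx ?mulr1 // (negPf k0) mulr0.
Qed.

Lemma alt_width_double r s m : alt_width r s m.*2 = r.
Proof. by elim: m. Qed.

Lemma alt_width_doubleS r s m : alt_width r s m.*2.+1 = s.
Proof. by elim: m. Qed.

(** The width reduces to [Nirr H] only for concrete m, hence the cast; one [e] serves for both m and
    m + 1, whose widths are convertible. *)
Lemma alt_pow_double m (e : alt_width (Nirr H) (Nirr G) m.*2 = Nirr H) i j :
  alt_pow M m.*2 i j = even_pow m i (cast_ord e j).
Proof.
elim: m e i j => [|m IHm] e i j.
  by rewrite /= !mxE; congr (_ == _)%:R; apply: val_inj.
have -> : alt_pow M m.+1.*2 = N *m alt_pow M m.*2 by rewrite -mulmxA.
rewrite mxE [RHS]mxE; apply: eq_bigr => k _; congr (_ * _); exact: IHm.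
Qed.

Lemma alt_pow_doubleS m (e : alt_width (Nirr H) (Nirr G) m.*2.+1 = Nirr G) i j :
  alt_pow M m.*2.+1 i j = (even_pow m *m M) i (cast_ord e j).
Proof.
elim: m e i j => [|m IHm] e i j.
  by rewrite mul1mx /=; congr (M _ _); apply: val_inj.
have -> : alt_pow M m.+1.*2.+1 = N *m alt_pow M m.*2.+1 by rewrite -mulmxA.
have -> : even_pow m.+1 *m M = N *m (even_pow m *m M) by rewrite mulmxA.
rewrite mxE [RHS]mxE; apply: eq_bigr => k _; congr (_ * _); exact: IHm.
Qed.

Lemma depth_ineq_odd m : depth_ineq M m.*2.+1 <->
  exists q, (0 < q)%N /\ forall i j, even_pow m.+1 i j <= q%:R * even_pow m i j.
Proof.
have e := alt_width_double (Nirr H) (Nirr G) m.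
split=> -[q [q0 le_q]]; exists q; split=> // i j.
  have := le_q i (cast_ord (esym e) j).
  rewrite (alt_pow_double (m := m.+1) e) (alt_pow_double e).
  by rewrite cast_ordKV.
by rewrite (alt_pow_double (m := m.+1) e) (alt_pow_double e).
Qed.

(** An even depth compares odd powers of [M]; in the column of the trivial character these agree
    with even powers. *)
Lemma depth_ineq_even m : depth_ineq M m.+1.*2 ->
  exists q, forall i, even_pow m.+1 i 0 <= q%:R * even_pow m i 0.
Proof.
have e := alt_width_doubleS (Nirr H) (Nirr G) m.
move=> -[q [_ le_q]]; exists q => i.
have := le_q i (cast_ord (esym e) 0).
rewrite (alt_pow_doubleS (m := m.+1) e) (alt_pow_doubleS e).
by rewrite cast_ordKV !even_pow_mul_col0.
Qed.

(** The entries are natural numbers, so nonzero ones are at least 1, and any bound on the entries of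
    the next power serves as q. *)
Lemma depth_ineq_full m : (forall i j, even_pow m i j != 0) -> depth_ineq M m.*2.+1.
Proof.
move=> nz; apply/depth_ineq_odd.
pose b i j := Num.truncn (even_pow m.+1 i j).
exists (\sum_i \sum_j b i j).+1; split=> // i j.
have le1 : 1 <= even_pow m i j.
  have /natrP[[|k] Ek] := even_pow_nat m i j; last by rewrite Ek ler1n.
  by move: (nz i j); rewrite Ek eqxx.
apply: le_trans (_ : (\sum_i \sum_j b i j).+1%:R <= _); last first.
  by rewrite ler_peMr // ler0n.
rewrite -(truncnK (even_pow_nat m.+1 i j)) ler_nat -/(b i j).
by rewrite (bigD1 i) //= (bigD1 j) //= -!addnA leqW // leq_addr.
Qed.

(** As [N] has nonnegative entries, multiplying by it carries the inequality to every later power;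
    hence a zero in column 0 persists. *)
Lemma even_pow_col0_eq0 q l m i : (l <= m)%N ->
    (forall k, even_pow l.+1 k 0 <= q%:R * even_pow l k 0) ->
  even_pow l i 0 = 0 -> even_pow m i 0 = 0.
Proof.
move=> le_lm le_q; rewrite -(subnKC le_lm); move: (m - l)%N => t Pl0.
have le_qt u k : even_pow (l + u).+1 k 0 <= q%:R * even_pow (l + u) k 0.
  elim: u k => [|u IHu] k; first by rewrite addn0.
  rewrite addnS [leLHS]mxE [X in _ * X]mxE mulr_sumr; apply: ler_sum => h _.
  by rewrite mulrCA ler_wpM2l ?IHu // natr_ge0 ?MMtr_nat.
elim: t => [|t IHt]; first by rewrite addn0.
apply/eqP; rewrite eq_le addnS natr_ge0 ?even_pow_nat // andbT.
by have := le_qt t i; rewrite IHt mulr0.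
Qed.

(** An inequality of smaller depth would keep the entry (i, 0) zero up to the power m, where all
    entries are nonzero. *)
Lemma has_depth_odd m : (0 < m)%N -> (forall i j, even_pow m i j != 0) ->
    (exists i, forall l, (l < m)%N -> even_pow l i 0 = 0) ->
  has_depth H G m.*2.+1.
Proof.
move=> m0 nz [i i0]; split; first by rewrite -(prednK m0).
  exact: depth_ineq_full.
move=> k k2 depth_k; rewrite leqNgt; apply/negP => lt_km.
suff [l lt_lm [q le_q]] : exists2 l, (l < m)%N &
    exists q, forall j, even_pow l.+1 j 0 <= q%:R * even_pow l j 0.
  have := nz i 0.
  by rewrite (even_pow_col0_eq0 (ltnW lt_lm) le_q (i0 l lt_lm)) eqxx.
(* A smaller depth is 2l + 1 or 2l + 2, with l < m in both cases. *)
move: k2 depth_k lt_km; rewrite -[k]odd_double_half.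
case: (odd k); rewrite (add0n, add1n) => k2 depth_k lt_km.
  exists k./2; first by lia.
  by have /depth_ineq_odd[q [_ le_q]] := depth_k; exists q.
case: (k./2) k2 depth_k lt_km => // l _ depth_l lt_lm.
exists l; first by lia.
exact: depth_ineq_even.
Qed.

End DepthCriterion.

(** * Sums of a character times a conjugate of another *)

Section ConjugateProduct.

Variables (gT : finGroupType) (H K : {group gT}) (a : gT).
Hypotheses (sKH : K \subset H) (sKaH : K :^ a \subset H).
Variables phi psi : 'CF(H).
Hypotheses (Nphi : phi \is a character) (Npsi : psi \is a character).

Lemma conj_char : exists2 theta : 'CF(K), theta \is a character &
  {in K, forall x, theta x = psi (x ^ a)%g}.
Proof.
have /char_reprP[[d rG] ->] := Npsi.
have Ka x : x \in K -> (x ^ a)%g \in H by move=> Kx; rewrite (subsetP sKaH) ?memJ_conjg.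
have rK : mx_repr K (fun x => rG (x ^ a)%g).
  split=> [|x y Kx Ky]; first by rewrite conj1g repr_mx1.
  by rewrite conjMg repr_mxM ?Ka.
exists (cfRepr (MxRepresentation rK)); first exact: cfRepr_char.
by move=> x Kx; rewrite !cfunE Kx Ka.
Qed.

(** Up to the order of K this is an inner product of characters of K. *)
Lemma sum_conj_char_ge0 : 0 <= \sum_(x in K) phi x * (psi (x ^ a)%g)^*.
Proof.
have [theta Ntheta thetaE] := conj_char.
rewrite (eq_bigr (fun x => phi x * (theta x)^*)) => [|x Kx]; last by rewrite thetaE.
rewrite (eq_bigr (fun x => 'Res[K] phi x * (theta x)^*)) => [|x Kx]; last by rewrite cfResE.
have -> : \sum_(x in K) 'Res[K] phi x * (theta x)^* = #|K|%:R * '['Res[K] phi, theta].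
  by rewrite cfdotE mulVKf ?neq0CG.
by rewrite mulr_ge0 ?ler0n // natr_ge0 // Cnat_cfdot_char ?cfRes_char.
Qed.

(** Both characters of K contain the trivial one, so they are not orthogonal. *)
Lemma sum_conj_char_neq0 : \sum_(x in K) phi x != 0 -> \sum_(x in K :^ a) psi x != 0 ->
  \sum_(x in K) phi x * (psi (x ^ a)%g)^* != 0.
Proof.
have [theta Ntheta thetaE] := conj_char; move=> phi1 psi1.
rewrite (eq_bigr (fun x => phi x * (theta x)^*)) => [|x Kx]; last by rewrite thetaE.
rewrite sum_cfun_cfdot // -cfdot_Res_l mulf_neq0 ?neq0CG //.
have dot1 (xi : 'CF(K)) : \sum_(x in K) xi x = #|K|%:R * '[xi, 'chi_0].
  rewrite irr0 cfdotE mulVKf ?neq0CG //.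
  by apply: eq_bigr => x Kx; rewrite cfun1E Kx conjC1 mulr1.
have phi0 : 0 \in irr_constt ('Res[K] phi).
  rewrite irr_consttE; apply: contraNneq phi1 => dot0.
  have := dot1 ('Res[K] phi); rewrite dot0 mulr0 => res0; rewrite -[X in _ == X]res0.
  by apply/eqP; apply: eq_bigr => x Kx; rewrite cfResE.
apply: contraNneq psi1 => /(constt_cfdot0 (cfRes_char _ Nphi) Ntheta)/(_ phi0) dot0.
have := dot1 theta; rewrite dot0 mulr0 => th0; rewrite -[X in _ == X]th0.
apply/eqP; rewrite (reindex_inj (conjg_inj a)) /=.
by apply: eq_big => [x|x]; rewrite memJ_conjg // => /thetaE ->.
Qed.

End ConjugateProduct.

(** * Powers of the permutation character on the points *)

Section PointStabilizer.

Variables (T : finType) (p : T).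
Implicit Types (x s t : {perm T}) (X Y Z : {set T}).

Let G : {group {perm T}} := ('Alt_T)%G.
Let H : {group {perm T}} := Alt_on [set~ p].

Lemma Alt_on_setC Y s :
  reflect (s \in G /\ {in Y, forall y, s y = y}) (s \in Alt_on (~: Y)).
Proof.
apply: (iffP (Alt_onP _ _)) => -[even_s sY]; split; rewrite ?Alt_even //.
- move=> y yY; apply: (@out_perm _ (~: Y)); first by rewrite inE in sY.
  by rewrite inE yY.
- by rewrite Alt_even in even_s.
rewrite inE; apply/subsetP=> z; rewrite !inE; apply: contraNN => /sY->.
exact: eqxx.
Qed.

Lemma point_stab_sub : H \subset G.
Proof. by apply/subsetP=> s /Alt_on_setC[]. Qed.

Lemma conj_point_stab s a : s \in G -> a \in G ->
  ((s ^ a)%g \in H) = (s (a^-1%g p) == a^-1%g p).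
Proof.
move=> sG aG; apply/Alt_on_setC/eqP => [[_ /(_ p)]|sap].
  rewrite inE eqxx => /(_ isT) sap.
  by apply: (@perm_inj _ a); rewrite -permJ !permKV.
split; first by rewrite memJ_norm // (subsetP (normG _)).
by move=> q /set1P->; rewrite -{1}[p](permKV a) permJ sap permKV.
Qed.

(** Points are given by group elements sending them to p, since the induced character is computed as
    a sum over the group. *)
Definition pulled_points m (f : {ffun 'I_m -> {perm T}}) := [set (f k)^-1%g p | k : 'I_m].

Lemma card_pulled_points m (f : {ffun 'I_m -> {perm T}}) :
  (#|pulled_points f| <= m)%N.
Proof. by apply: leq_trans (leq_imset_card _ _) _; rewrite card_ord. Qed.

Lemma Ind1_pointE s : s \in G ->
  'Ind[G, H] 1 s = #|H|%:R^-1 * \sum_(a in G) (s (a^-1%g p) == a^-1%g p)%:R.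
Proof.
move=> sG; rewrite cfIndE ?point_stab_sub //; congr (_ * _).
by apply: eq_bigr => a aG; rewrite cfun1E conj_point_stab.
Qed.

Lemma Ind1_point_powE m s : s \in G -> ('Ind[G, H] 1 ^+ m) s =
  #|H|%:R^-1 ^+ m * \sum_(f : {ffun 'I_m -> {perm T}} | f \in ffun_on G)
    (s \in Alt_on (~: pulled_points f))%:R.
Proof.
move=> sG.
have -> : ('Ind[G, H] 1 ^+ m) s = \prod_(k < m) 'Ind[G, H] 1 s.
  by rewrite prodr_const card_ord; elim: m => [|m IHm];
     rewrite ?expr0 ?cfun1E ?sG // !exprS cfunE IHm.
under eq_bigr do rewrite Ind1_pointE //.
rewrite big_split prodr_const card_ord /= bigA_distr_big /=; congr (_ * _).
apply: eq_bigr => f fG.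
have [/forallP fix_s|] := boolP [forall k, s ((f k)^-1%g p) == (f k)^-1%g p].
  rewrite big1 => [|k _]; last by rewrite fix_s.
  suff -> : s \in Alt_on (~: pulled_points f) by [].
  by apply/Alt_on_setC; split=> // _ /imsetP[k _ ->]; apply/eqP.
rewrite negb_forall => /existsP[k sk]; rewrite (bigD1 k) //= (negPf sk) mul0r.
suff /negPf-> : s \notin Alt_on (~: pulled_points f) by [].
by apply: contra sk => /Alt_on_setC[_ sf]; rewrite sf ?imset_f.
Qed.

Lemma sum_Ind1_point_pow m (F : {perm T} -> algC) (K : {group {perm T}}) : K \subset G ->
  \sum_(s in K) F s * ('Ind[G, H] 1 ^+ m) s =
  #|H|%:R^-1 ^+ m * \sum_(f : {ffun 'I_m -> {perm T}} | f \in ffun_on G)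
    \sum_(s in K :&: Alt_on (~: pulled_points f)) F s.
Proof.
move=> sKG; under eq_bigr => s Ks do rewrite Ind1_point_powE ?(subsetP sKG) // mulrCA mulr_sumr.
rewrite -mulr_sumr exchange_big; congr (_ * _); apply: eq_bigr => f _ /=.
rewrite (big_setID (Alt_on (~: pulled_points f))) /= [X in _ + X]big1 ?addr0.
  by apply: eq_bigr => s /setIP[_ ->]; rewrite mulr1.
by move=> s /setDP[_ /negPf->]; rewrite mulr0.
Qed.

Lemma Alt_on_setI X Y : Alt_on X :&: Alt_on Y = Alt_on (X :&: Y) :> {set {perm T}}.
Proof.
rewrite -[X]setCK -[Y]setCK -setCU; apply/setP => s; rewrite in_setI.
apply/andP/Alt_on_setC => [[/Alt_on_setC[sG sX] /Alt_on_setC[_ sY]]|[sG sXY]].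
  by split=> // y /setUP[/sX|/sY].
by split; apply/Alt_on_setC; split=> // y yX; apply: sXY; rewrite inE yX ?orbT.
Qed.

Lemma Ind1_point_conj s : s \in G -> (('Ind[G, H] 1) s)^* = 'Ind[G, H] 1 s.
Proof.
move=> sG; rewrite Ind1_pointE // rmorphM fmorphV rmorph_nat rmorph_sum /=.
by congr (_ * _); apply: eq_bigr => a _; rewrite rmorph_nat.
Qed.

Lemma Ind1_point_pow_conj m s : s \in G ->
  (('Ind[G, H] 1 ^+ m) s)^* = ('Ind[G, H] 1 ^+ m) s.
Proof.
move=> sG; elim: m => [|m IHm]; first by rewrite expr0 cfun1E rmorph_nat.
by rewrite exprS cfunE rmorphM /= IHm Ind1_point_conj.
Qed.

(** The expansion leaves sums over alternating groups on the points not pulled; at most l points are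
    removed, so more than c remain. *)
Lemma cfdot_Ind1_point_pow_eq0 c l (i : Iirr H) :
    (forall X, X \subset [set~ p] -> (c < #|X|)%N -> \sum_(s in Alt_on X) 'chi_i s = 0) ->
    (c + l < #|[set~ p]|)%N ->
  '['Res[H] ('Ind[G, H] 1 ^+ l), 'chi_i] = 0.
Proof.
move=> no_fix lt_cl; rewrite cfdotC cfdotE.
rewrite (eq_bigr (fun s => 'chi_i s * ('Ind[G, H] 1 ^+ l) s)) => [|s Hs]; last first.
  have sG := subsetP point_stab_sub s Hs.
  by rewrite cfResE ?point_stab_sub // Ind1_point_pow_conj.
rewrite sum_Ind1_point_pow ?point_stab_sub // big1 ?mulr0 ?conjC0 // => f _.
rewrite Alt_on_setI; apply: no_fix; first exact: subsetIl.
rewrite -setDE; have := cardsID (pulled_points f) [set~ p].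
have := subset_leq_card (subsetIr [set~ p] (pulled_points f)).
have := card_pulled_points f; lia.
Qed.

(** The transposition of q and p is odd; a third point z turns it into a 3-cycle. *)
Lemma Alt_point_transitive q : (2 < #|T|)%N -> exists2 a, a \in G & a^-1%g p = q.
Proof.
move=> T3; have [->|qp] := eqVneq q p.
  by exists 1%g; rewrite ?group1 // invg1 perm1.
have /subsetPn[z _] : ~~ (setT \subset [set p; q]).
  apply: contraL T3 => /subset_leq_card; rewrite cardsT cards2 -leqNgt => /leq_trans; apply.
  by case: (p != q).
rewrite !inE negb_or => /andP[zp zq].
exists (tperm q p * tperm q z)%g.
  by rewrite Alt_even odd_permM !odd_tperm qp eq_sym zq.
apply: (@perm_inj _ (tperm q p * tperm q z)%g).
by rewrite permKV permM tpermL tpermD // eq_sym.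
Qed.

(** The inner product expands into nonnegative terms. The term of (a, f) is a sum over the even
    permutations fixing p, the pulled points of f and the preimage of p under a; a suitable choice
    leaves exactly c points, where both characters have invariants. *)
Lemma cfdot_ResInd_point_neq0 c (i j : Iirr H) :
    (1 < c)%N -> (c.-1 ^ 2 < #|[set~ p]|)%N -> (c < #|[set~ p]|)%N ->
  '['Res[H] ('Ind[G] 'chi_j * 'Ind[G, H] 1 ^+ (#|[set~ p]| - c).-1), 'chi_i] != 0.
Proof.
move=> c1 lt_c2 lt_c; set m := (_ - c).-1.
have sHG := point_stab_sub.
pose K (a : {perm T}) (f : {ffun 'I_m -> {perm T}}) : {group {perm T}} :=
  Alt_on ([set~ p] :&: ~: pulled_points f :&: [set~ (a^-1)%g p]).
pose S (a : {perm T}) f := \sum_(s in K a f) 'chi_i s * ('chi_j (s ^ a)%g)^*.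
have KE a f : K a f =
    H :&: Alt_on (~: pulled_points f) :&: Alt_on [set~ (a^-1)%g p] :> {set {perm T}}.
  by rewrite !Alt_on_setI.
have KH a f : K a f \subset H by rewrite Alt_onS // -setIA subsetIl.
have KaH a f : a \in G -> (K a f :^ a)%g \subset H.
  move=> aG; apply/subsetP=> _ /imsetP[s Ks ->].
  have sG := subsetP sHG s (subsetP (KH a f) s Ks).
  rewrite conj_point_stab //; have sa : s \in Alt_on [set~ (a^-1)%g p].
    by apply: subsetP Ks; rewrite Alt_onS // subsetIr.
  by have /Alt_on_setC[_ ->] := sa; rewrite ?set11.
have S_ge0 a f : a \in G -> 0 <= S a f.
  by move=> aG; apply: sum_conj_char_ge0; rewrite ?irr_char ?KaH.
have main : \sum_(s in H) 'chi_i s * ((('Ind[G] 'chi_j) * 'Ind[G, H] 1 ^+ m) s)^* =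
    #|H|%:R^-1 * \sum_(a in G) (#|H|%:R^-1 ^+ m * \sum_(f in ffun_on G) S a f).
  transitivity (#|H|%:R^-1 * \sum_(a in G) \sum_(s in H)
      ('chi_i s * ('chi_j (s ^ a)%g)^*) * ('Ind[G, H] 1 ^+ m) s).
    rewrite exchange_big mulr_sumr; apply: eq_bigr => s Hs /=.
    have sG := subsetP sHG s Hs.
    rewrite cfunE rmorphM /= Ind1_point_pow_conj // cfIndE // rmorphM fmorphV rmorph_nat.
    rewrite -mulr_suml -mulr_sumr rmorph_sum /= !mulrA; congr (_ * _ * _).
    exact: mulrC.
  congr (_ * _); apply: eq_bigr => a aG; rewrite sum_Ind1_point_pow //; congr (_ * _).
  apply: eq_bigr => f _; rewrite /S KE.
  rewrite (big_setID (Alt_on [set~ (a^-1)%g p])) /= [X in _ + X]big1 ?addr0 //.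
  move=> s /setDP[/setIP[Hs _] Kas]; have sG := subsetP sHG s Hs.
  rewrite [X in _ * X^*]cfun0 ?conjC0 ?mulr0 //.
  rewrite conj_point_stab //; apply: contra Kas => /eqP sap.
  by apply/Alt_on_setC; split=> // _ /set1P->.
rewrite cfdotC cfdotE fmorph_eq0 mulf_neq0 ?invr_eq0 ?neq0CG //.
under eq_bigr do rewrite cfResE //.
rewrite main mulf_neq0 ?invr_eq0 ?neq0CG // -mulr_sumr.
rewrite mulf_neq0 ?expf_neq0 ?invr_eq0 ?neq0CG //.
have [Z sZ cZ] := exists_subset_card (ltnW lt_c).
(* One point q of [U] comes from a and the other m from f, whence the predecessor in the
   exponent. *)
pose U := [set~ p] :\: Z.
have cU : #|U| = m.+1.
  have := cardsID Z [set~ p]; rewrite (setIidPr sZ) cZ -/U /m.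
  lia.
have [q qU] : exists q, q \in U by apply/card_gt0P; rewrite cU.
have T3 : (2 < #|T|)%N.
  by have := cardsC1 p; lia.
have [a aG ap] := Alt_point_transitive q T3.
have cUq : #|U :\ q| = m by have := cardsD1 q U; rewrite qU cU; lia.
pose y (k : 'I_m) := enum_val (cast_ord (esym cUq) k).
have /fin_all_exists2[g gG gp] k : exists2 b, b \in G & b^-1%g p = y k.
  exact: Alt_point_transitive.
pose f := [ffun k : 'I_m => g k].
have fG : f \in ffun_on G by apply/ffun_onP=> k; rewrite ffunE.
have pf : pulled_points f = U :\ q.
  apply/setP=> z; apply/imsetP/idP => [[k _ ->]|zU]; first by rewrite ffunE gp enum_valP.
  exists (cast_ord cUq (enum_rank_in zU z)) => //.
  by rewrite ffunE gp /y cast_ordK enum_rankK_in.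
have KZ : K a f = Alt_on Z.
  apply: val_inj; rewrite /K pf ap /=; congr (_ :&: Sym _).
  apply/setP=> z; rewrite !inE; have := subsetP sZ z; rewrite !inE.
  have := qU; rewrite !inE => /andP[qZ _].
  have [->|_] := eqVneq z q; first by rewrite (negPf qZ) andbF.
  by case: (z \in Z) => [->//|_]; rewrite !andbT; case: (z != p).
have Saf : S a f != 0.
  apply: sum_conj_char_neq0; rewrite ?irr_char ?KH ?KaH // KZ.
    exact: irr_Alt_on_fixed lt_c2 sZ cZ.
  have -> : \sum_(s in Alt_on Z :^ a) 'chi_j s = \sum_(s in Alt_on (a @: Z)) 'chi_j s.
    apply: eq_bigl => s; rewrite -[s](conjgKV a) memJ_conjg Alt_on_imJ //.
  apply: irr_Alt_on_fixed lt_c2 _ _ => //; last by rewrite card_imset //; apply: perm_inj.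
  apply/subsetP=> _ /imsetP[z zZ ->]; rewrite !inE; apply: contraTneq zZ => azp.
  have -> : z = q by rewrite -ap -azp permK.
  by move: qU; rewrite !inE => /andP[].
rewrite gt_eqF // (bigD1 a) //= ltr_wpDr //.
  by apply: sumr_ge0 => b /andP[bG _]; apply: sumr_ge0 => h _; apply: S_ge0.
rewrite (bigD1 f) //= ltr_wpDr //; first by apply: sumr_ge0 => h _; apply: S_ge0.
by rewrite lt0r Saf S_ge0.
Qed.

End PointStabilizer.

(** * Bounds for [ceil_sqrt], and the depth *)

Lemma ceil_sqrt_bounds n : (0 < n)%N ->
  ((ceil_sqrt n).-1 ^ 2 < n <= ceil_sqrt n ^ 2)%N.
Proof.
move=> n_gt0; have sn0 : 0 <= sqrtC n%:R :> algC by rewrite sqrtC_ge0 ler0n.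
have leP k : (ceil_sqrt n <= k)%N = (n <= k ^ 2)%N.
  rewrite -lez_nat ceil_sqrtE real_ceil_le_int ?ger0_real // -pmulrn.
  rewrite -(@ler_pXn2r _ 2) ?nnegrE ?ler0n // sqrtCK.
  by rewrite -natrX ler_nat.
rewrite -leP leqnn andbT ltnNge -leP -ltnNge ltn_predL lt0n.
by apply: contraTneq n_gt0 => c0; rewrite -leqNgt; have := leP 0; rewrite c0.
Qed.

Lemma std_AltE n : std_Alt n = Alt_on [set~ ord_max].
Proof.
apply/group_inj/setP => s; apply/morphimP/Alt_on_setC => [[t _ At ->]|[As sfix]].
  by rewrite Alt_even /lift_last odd_lift_perm addbb -Alt_even; split=> // _ /set1P->;
     rewrite lift_perm_id.
have smax : s ord_max = ord_max by rewrite sfix ?set11.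
have sl j : exists i, s (lift ord_max j) = lift ord_max i.
  case: (unliftP ord_max (s (lift ord_max j))) => [i ->|]; first by exists i.
  by rewrite -{2}smax => /perm_inj/eqP; rewrite eq_sym (negPf (neq_lift _ _)).
have [u su] := fin_all_exists sl.
have u_inj : injective u.
  by move=> i j uij; apply/(@lift_inj _ ord_max)/(@perm_inj _ s); rewrite !su uij.
have Es : s = lift_last (perm u_inj).
  apply/permP => j; case: (unliftP ord_max j) => [i ->|->].
    by rewrite /lift_last lift_perm_lift permE su.
  by rewrite lift_perm_id smax.
exists (perm u_inj) => //.
by move: As; rewrite Es !Alt_even odd_lift_perm addbb.
Qed.

Theorem propositionA5 (n : nat) (hn : (3 <= n)%N) :
  has_depth (std_Alt n) ('Alt_('I_n.+1))%G (2 * (n - ceil_sqrt n) + 1)%N.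
Proof.
set c := ceil_sqrt n; have /andP[lt_c2 le_c2] : (c.-1 ^ 2 < n <= c ^ 2)%N.
  by apply: ceil_sqrt_bounds; apply: leq_trans hn.
have c_gt1 : (1 < c)%N.
  by rewrite ltnNge; apply: contraTN le_c2 => le_c1; rewrite -ltnNge;
     case: (c) le_c1 => [|[]] //= _; apply: leq_trans hn.
(* From n <= c would follow (n - 1)^2 < n, which fails for n at least 3. *)
have lt_cn : (c < n)%N by nia.
have cardD : #|[set~ (ord_max : 'I_n.+1)]| = n by rewrite cardsC1 card_ord.
pose D := [set~ (ord_max : 'I_n.+1)].
rewrite std_AltE mul2n addn1.
apply: has_depth_odd; first exact: point_stab_sub; first by rewrite subn_gt0.
  move=> i j; rewrite even_powE -(prednK (n := n - c)) ?subn_gt0 //.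
  rewrite iter_ResInd_S ?point_stab_sub //.
  have := @cfdot_ResInd_point_neq0 _ ord_max c i j c_gt1.
  by rewrite cardD => /(_ lt_c2 lt_cn).
(* The points are numbered from 0 to n - 1; quotient and remainder by c are the grid coordinates,
   and n <= c^2 bounds the number of rows by c. *)
pose r x := (index x (enum D) %/ c)%N; pose k x := (index x (enum D) %% c)%N.
have c_gt0 : (0 < c)%N by apply: ltnW.
have [| | |i no_fix] := @irr_Alt_on_no_fixed _ D r k c.
- move=> x xD; rewrite ltn_divLR //; apply: leq_trans le_c2.
  by rewrite -[ltnRHS]cardD cardE index_mem mem_enum.
- by move=> x _; rewrite ltn_mod.
- move=> x y xD yD rxy kxy; have : index x (enum D) = index y (enum D).
    by rewrite (divn_eq (index x _) c) (divn_eq (index y _) c) -/(r x) -/(k x) rxy kxy.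
  by move/(congr1 (nth x (enum D))); rewrite !nth_index ?mem_enum.
exists i => l lt_l; rewrite even_powE irr0 iter_ResInd_1 ?point_stab_sub //.
apply: (cfdot_Ind1_point_pow_eq0 no_fix); rewrite cardD; lia.
Qed.
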